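(* Let $(K,\phi)$ be a one vertex Kan complex with $\pi=\pi_1(K,\phi)$, let $G$ be a discrete group acting simplicially on $K$, and let $H\le\pi$ be a normal subgroup such that the action by any element of $G$ preserves $H$, i.e. $g_*(H)=H$ for all $g\in G$. Let $\varphi\colon G\to\operatorname{Aut}(\pi/H)$ be the induced homomorphism, and let $$1\longrightarrow \pi/H\longrightarrow L\xrightarrow{\ \eta\ } G\longrightarrow 1$$ be the split extension determined by $\varphi$. Let $p\colon\widetilde K_H\to K$ be the covering projection of the regular cover of $K$ corresponding to $H$, and let $\pi/H$ act on $\widetilde K_H$ by $\psi\colon\pi/H\to\operatorname{Aut}(\widetilde K_H)$, given by multiplication on the right in the second factor. Then the $\pi/H$-action on $\widetilde K_H$ can be extended to an $L$-action on $\widetilde K_H$ such that, under $\eta\times p\colon (L,\widetilde K_H)\to(G,K)$, the action $(L,\widetilde K_H)$ covers the action $(G,K)$, i.e. $p$ is equivariant with respect to $\eta$. Furthermore, there is a natural isomorphism between the isotropy groups $G_{p(x)}$ and $L_x$, where $x\in\widetilde K_H$.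
   Context: A one vertex Kan complex $(K,\phi)$ is a Kan complex with exactly one $0$-simplex $\phi$. Every $1$-simplex $x\in K_1$ represents a class $[x]\in\pi=\pi_1(K,\phi)$, and multiplication in $\pi$ follows the convention $[\partial_1 z]=[\partial_0 z][\partial_2 z]$ for every $2$-simplex $z\in K_2$. A simplicial action of $G$ on $K$ induces a homomorphism $G\to\operatorname{Aut}(\pi)$, $g\mapsto g_*$, with $g_*[x]=[gx]$. If $g_*(H)=H$ for all $g\in G$, then $\varphi(g)\in\operatorname{Aut}(\pi/H)$ denotes the automorphism induced by $g_*$. For a normal subgroup $H\le\pi$, the regular cover $\widetilde K_H$ of $K$ corresponding to $H$ is the Kan complex with $(\widetilde K_H)_n=K_n\times\pi/H$ and $\partial_i(x,\overline\alpha)=(\partial_i x,\overline\alpha)$ for $0\le i<n$, $\partial_n(x,\overline\alpha)=(\partial_n x,[\partial_0^{\,n-1}x]^{-1}\overline\alpha)$, $s_i(x,\overline\alpha)=(s_ix,\overline\alpha)$ for $0\le i\le n$, where $\overline\alpha$ denotes the coset in $\pi/H$ of $\alpha\in\pi$; the covering projection is $p(x,\overline\alpha)=x$. The group $\pi/H$ acts simplicially on the right of $\widetilde K_H$ by multiplication on the second factor; this is denoted $\psi\colon\pi/H\to\operatorname{Aut}(\widetilde K_H)$, with $(k,\overline\alpha)\overline\beta:=(k,\overline\alpha\,\overline\beta)$, that is, $\psi(\overline\beta)(k,\overline\alpha)=(k,\overline\alpha\,\overline\beta)$. The split extension determined by $\varphi$ is $L=\pi/H\times G$ as a set, with multiplication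 $(\overline\alpha,f)\cdot(\overline\beta,g)=(\overline\alpha\,\varphi(f)(\overline\beta),fg)$, and $\eta(\overline\alpha,f)=f$. For a simplex $y$, $G_y$ (respectively $L_y$) denotes the isotropy subgroup of $y$ in $G$ (respectively $L$). *)

(* Defs.v *)
From HB Require Import structures.
From mathcomp Require Import all_boot boolp classical_sets.

Set Implicit Arguments.
Unset Strict Implicit.
Unset Printing Implicit Defensive.

Local Open Scope quotient_scope.
Local Open Scope classical_set_scope.
Local Open Scope group_scope.

Notation ord_succ := (lift ord0).
Notation ord_widen := (widen_ord (leqnSn _)).

(* The index of each face and degeneracy operator is an ordinal, so that
   [face i : K n.+1 -> K n] has 0 <= i <= n+1 and [degen i : K n -> K n.+1] has
   0 <= i <= n.  [ord_succ i] has value i+1 and [ord_widen i] has value i. *)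
Record sset := SSet {
  spx :> nat -> Type;
  face : forall n, 'I_n.+2 -> spx n.+1 -> spx n;
  degen : forall n, 'I_n.+1 -> spx n -> spx n.+1;
  face_face : forall n (i j : 'I_n.+2) (x : spx n.+2), i <= j ->
    face i (face (ord_succ j) x) = face j (face (ord_widen i) x);
  degen_degen : forall n (i j : 'I_n.+1) (x : spx n), i <= j ->
    degen (ord_succ j) (degen i x) = degen (ord_widen i) (degen j x);
  face_degen_le : forall n (i : 'I_n.+2) (j : 'I_n.+1) (x : spx n.+1),
    i <= j -> face (ord_widen i) (degen (ord_succ j) x) = degen j (face i x);
  face_degen_id : forall n (j : 'I_n.+1) (x : spx n),
    face (ord_widen j) (degen j x) = x;
  face_degen_succ : forall n (j : 'I_n.+1) (x : spx n),
    face (ord_succ j) (degen j x) = x;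
  face_degen_gt : forall n (i : 'I_n.+2) (j : 'I_n.+1) (x : spx n.+1),
    j < i -> face (ord_succ i) (degen (ord_widen j) x) = degen j (face i x)
}.
Arguments face {s n}.
Arguments degen {s n}.

(* The k-th entry of the family [y] is irrelevant.  The omitted horns, those of
   the 1-simplex, always have a (degenerate) filler. *)
Definition is_kan (K : sset) : Prop :=
  forall n (k : 'I_n.+3) (y : 'I_n.+3 -> K n.+1),
    (forall i j : 'I_n.+2, i <= j -> ord_widen i != k -> ord_succ j != k ->
      face i (y (ord_succ j)) = face j (y (ord_widen i))) ->
    exists x : K n.+2, forall i, i != k -> face i x = y i.

Record smap (K M : sset) := SMap {
  sfun :> forall n, K n -> M n;
  sfun_face : forall n (i : 'I_n.+2) (x : K n.+1),
    sfun (face i x) = face i (sfun x);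
  sfun_degen : forall n (i : 'I_n.+1) (x : K n),
    sfun (degen i x) = degen i (sfun x)
}.
Arguments sfun {K M} s n.

Record saction (G : groupType) (K : sset) := SAction {
  sact :> G -> smap K K;
  sact1 : forall n (x : K n), sact 1 n x = x;
  sactM : forall g h n (x : K n), sact (g * h) n x = sact g n (sact h n x)
}.

Record sraction (G : groupType) (K : sset) := SRAction {
  sract :> G -> smap K K;
  sract1 : forall n (x : K n), sract 1 n x = x;
  sractM : forall g h n (x : K n), sract (g * h) n x = sract h n (sract g n x)
}.

(* The left action associated with a right action: g acts by g^-1.  A left
   action can only extend a right action in this sense, as the map from the
   group to automorphisms given by a right action is an anti-homomorphism. *)
Section LeftOfRight.
Variables (G : groupType) (K : sset) (R : sraction G K).

Definition left_of_right_map (g : G) : smap K K := R g^-1.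

Fact left_of_right1 n (x : K n) : left_of_right_map 1 n x = x.
Proof. by rewrite /left_of_right_map invg1 sract1. Qed.

Fact left_of_rightM g h n (x : K n) :
  left_of_right_map (g * h) n x =
    left_of_right_map g n (left_of_right_map h n x).
Proof. by rewrite /left_of_right_map invgM sractM. Qed.

Definition left_of_right : saction G K :=
  SAction left_of_right1 left_of_rightM.
End LeftOfRight.

Section Isotropy.
Variables (G : groupType) (K : sset) (A : saction G K) (n : nat) (x : K n).

Definition isotropy_pred : pred G := fun g => `[< A g n x = x >].

Definition isotropy : Type := {g : G | isotropy_pred g}.

Fact isotropy_group_closed : group_closed isotropy_pred.
Proof.
split=> [|g h]; first by apply/asboolP; rewrite sact1.
rewrite !unfold_in => /asboolP gx /asboolP hx; apply/asboolP.
have hVx : A h^-1 n x = x by rewrite -{1}hx -sactM mulVg sact1.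
by rewrite sactM hVx.
Qed.

HB.instance Definition _ := SubChoice.on isotropy.
HB.instance Definition _ :=
  SubChoice_isSubGroup.Build G isotropy_pred isotropy isotropy_group_closed.
End Isotropy.

Record ovkan := OVKan {
  ov_sset :> sset;
  vertex : ov_sset 0;
  vertexP : forall v : ov_sset 0, v = vertex;
  ov_kan : is_kan ov_sset
}.

Section Pi1.
Variable K : ovkan.

(* A 2-simplex with faces a, b, c, which witnesses [b] = [a][c]. *)
Definition triangle (a b c : K 1%N) : Prop :=
  exists z : K 2, [/\ face (inord 0) z = a, face (inord 1%N) z = b
                    & face (inord 2) z = c].

Definition const1 : K 1%N := degen ord0 (vertex K).

(* Homotopy relative to the boundary, which is automatic with one vertex. *)
Definition homot (x y : K 1%N) : Prop := triangle const1 x y.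

Lemma vertex_eq (u v : K 0) : u = v.
Proof. by rewrite (vertexP u) (vertexP v). Qed.

Lemma ord2E (i : 'I_2) : i = inord 0 \/ i = inord 1%N.
Proof.
by case: i => [[|[|//]] p]; [left|right]; apply: val_inj; rewrite /= inordK.
Qed.

Lemma ord3E (i : 'I_3) : [\/ i = inord 0, i = inord 1%N | i = inord 2].
Proof.
by case: i => [[|[|[|//]]] p];
  [apply: Or31|apply: Or32|apply: Or33]; apply: val_inj; rewrite /= inordK.
Qed.

Lemma succ_inord n i : i < n.+1 -> ord_succ (inord i : 'I_n.+1) = inord i.+1.
Proof. by move=> h; apply: val_inj; rewrite /= /bump /= !inordK. Qed.

Lemma widen_inord n i : i < n.+1 -> ord_widen (inord i : 'I_n.+1) = inord i.
Proof. by move=> h; apply: val_inj; rewrite /= !inordK // ltnW. Qed.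

Lemma ffE n (i j : nat) (x : K n.+2) : i <= j -> j < n.+2 ->
  face (inord i) (face (inord j.+1) x) = face (inord j) (face (inord i) x).
Proof.
move=> ij jn; have im := leq_ltn_trans ij jn.
by rewrite -succ_inord // face_face ?inordK // widen_inord.
Qed.

Lemma triangle_deg0 x : triangle x x const1.
Proof.
exists (degen (inord 0) x); split.
- by rewrite -widen_inord // face_degen_id.
- by rewrite -succ_inord // face_degen_succ.
- rewrite (_ : inord 0 = ord_widen (inord 0 : 'I_1)) ?widen_inord //.
  rewrite -(widen_inord (n := 0)) // -(succ_inord (n := 1)) // face_degen_gt.
    by rewrite (vertexP (face _ _)) [inord 0]ord1.
  by rewrite !inordK.
Qed.

Lemma triangle_deg1 x : triangle const1 x x.
Proof.
exists (degen (inord 1%N) x); split.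
- rewrite -(succ_inord (n := 0)) // -(widen_inord (n := 1)) // face_degen_le.
    by rewrite (vertexP (face _ _)) [inord 0]ord1.
  by rewrite !inordK.
- by rewrite -(widen_inord (n := 1)) // face_degen_id.
- by rewrite -(succ_inord (n := 1)) // face_degen_succ.
Qed.

Lemma homot_refl x : homot x x. Proof. exact: triangle_deg1. Qed.

Lemma horn2 (k : 'I_3) (y : 'I_3 -> K 1%N) :
  exists z : K 2, forall i, i != k -> face i z = y i.
Proof. by apply: ov_kan => *; exact: vertex_eq. Qed.

Lemma triangle_fill1 a c : exists b, triangle a b c.
Proof.
have [z hz] := horn2 (inord 1%N) (fun i => if i == inord 0 then a else c).
exists (face (inord 1%N) z), z; split=> //; rewrite hz ?eqxx //;
  by rewrite -?val_eqE /= ?inordK.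
Qed.

Lemma triangle_fill2 a b : exists c, triangle a b c.
Proof.
have [z hz] := horn2 (inord 2) (fun i => if i == inord 0 then a else b).
exists (face (inord 2) z), z; split=> //; rewrite hz ?eqxx //;
  by rewrite -?val_eqE /= ?inordK.
Qed.

Lemma triangle_fill0 b c : exists a, triangle a b c.
Proof.
have [z hz] := horn2 (inord 0) (fun i => if i == inord 1%N then b else c).
exists (face (inord 0) z), z; split=> //; rewrite hz ?eqxx //;
  by rewrite -?val_eqE /= ?inordK.
Qed.

(* The edge of a 3-simplex between vertices i < j is called aij. *)
Section Tetrahedron.
Variables a01 a02 a03 a12 a13 a23 : K 1%N.

Let y (z0 z1 z2 z3 : K 2) (i : 'I_4) : K 2 :=
  if i == inord 0 then z0 else if i == inord 1%N then z1 else
  if i == inord 2 then z2 else z3.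

Let y0 z0 z1 z2 z3 : y z0 z1 z2 z3 (inord 0) = z0.
Proof. by rewrite /y eqxx. Qed.
Let y1 z0 z1 z2 z3 : y z0 z1 z2 z3 (inord 1%N) = z1.
Proof. by rewrite /y -!val_eqE /= !inordK. Qed.
Let y2 z0 z1 z2 z3 : y z0 z1 z2 z3 (inord 2) = z2.
Proof. by rewrite /y -!val_eqE /= !inordK. Qed.
Let y3 z0 z1 z2 z3 : y z0 z1 z2 z3 (inord 3) = z3.
Proof. by rewrite /y -!val_eqE /= !inordK. Qed.

Let inord_neq i j : i < 4 -> j < 4 -> i != j -> (inord i : 'I_4) != inord j.
Proof. by move=> i4 j4; rewrite -val_eqE /= !inordK. Qed.

Lemma tetra3 : triangle a23 a13 a12 -> triangle a23 a03 a02 ->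
  triangle a13 a03 a01 -> triangle a12 a02 a01.
Proof.
move=> [z0 [p0 p1 p2]] [z1 [q0 q1 q2]] [z2 [r0 r1 r2]].
have [|w hw] := ov_kan (k := inord 3) (y := y z0 z1 z2 z0).
  move=> i j; case: (ord3E i) => ->; case: (ord3E j) => ->;
  rewrite ?inordK // => _; rewrite ?succ_inord ?widen_inord ?eqxx //;
  by rewrite ?y0 ?y1 ?y2 ?p0 ?p1 ?p2 ?q0 ?q1 ?q2 ?r0 ?r1 ?r2.
have w0 : face (inord 0) w = z0 by rewrite hw ?y0 ?inord_neq.
have w1 : face (inord 1%N) w = z1 by rewrite hw ?y1 ?inord_neq.
have w2 : face (inord 2) w = z2 by rewrite hw ?y2 ?inord_neq.
exists (face (inord 3) w); split.
- by rewrite ffE // w0.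
- by rewrite ffE // w1.
- by rewrite ffE // w2.
Qed.

Lemma tetra1 : triangle a23 a13 a12 -> triangle a13 a03 a01 ->
  triangle a12 a02 a01 -> triangle a23 a03 a02.
Proof.
move=> [z0 [p0 p1 p2]] [z2 [r0 r1 r2]] [z3 [s0 s1 s2]].
have [|w hw] := ov_kan (k := inord 1%N) (y := y z0 z0 z2 z3).
  move=> i j; case: (ord3E i) => ->; case: (ord3E j) => ->;
  rewrite ?inordK // => _; rewrite ?succ_inord ?widen_inord ?eqxx //;
  by rewrite ?y0 ?y2 ?y3 ?p0 ?p1 ?p2 ?r0 ?r1 ?r2 ?s0 ?s1 ?s2.
have w0 : face (inord 0) w = z0 by rewrite hw ?y0 ?inord_neq.
have w2 : face (inord 2) w = z2 by rewrite hw ?y2 ?inord_neq.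
have w3 : face (inord 3) w = z3 by rewrite hw ?y3 ?inord_neq.
exists (face (inord 1%N) w); split.
- by rewrite ffE // w0.
- by rewrite -ffE // w2.
- by rewrite -ffE // w3.
Qed.
End Tetrahedron.

Lemma homot_euclid x y z : homot x y -> homot x z -> homot y z.
Proof.
by move=> xy xz; apply: tetra3 xy xz; exact: homot_refl.
Qed.

Lemma homot_sym x y : homot x y -> homot y x.
Proof. by move=> xy; exact: homot_euclid xy (homot_refl x). Qed.

Lemma homot_trans y x z : homot x y -> homot y z -> homot x z.
Proof. by move=> /homot_sym; exact: homot_euclid. Qed.

Lemma triangle_homot a b c a' b' c' : homot a a' -> homot b b' ->
  homot c c' -> triangle a b c -> triangle a' b' c'.
Proof.
move=> aa bb cc t.
have t1 : triangle a' b c by exact: tetra3 aa (homot_refl b) t.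
have t2 : triangle a' b' c by exact: tetra3 (homot_refl a') bb t1.
have [b2 t3] := triangle_fill1 a' c'.
have t4 : triangle a' b2 c by exact: tetra1 (triangle_deg0 a') t3 cc.
have t5 : homot b2 b' by exact: tetra1 (homot_refl a') t4 t2.
exact: tetra3 (homot_refl a') t5 t3.
Qed.

Lemma triangle_uniq a b b' c : triangle a b c -> triangle a b' c -> homot b b'.
Proof. exact: tetra1 (homot_refl a). Qed.

Definition homot_rel : rel {classic K 1%N} := fun x y => `[< homot x y >].

Fact homot_rel_refl : reflexive homot_rel.
Proof. by move=> x; apply/asboolP; exact: homot_refl. Qed.

Fact homot_rel_sym : symmetric homot_rel.
Proof. by move=> x y; apply: asbool_equiv_eq; split; exact: homot_sym. Qed.

Fact homot_rel_trans : transitive homot_rel.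
Proof.
by move=> y x z /asboolP xy /asboolP yz; apply/asboolP; exact: homot_trans yz.
Qed.

Canonical homot_equiv :=
  EquivRel homot_rel homot_rel_refl homot_rel_sym homot_rel_trans.

Definition pi1 : Type := {eq_quot homot_equiv}.
HB.instance Definition _ := Choice.on pi1.
HB.instance Definition _ := EqQuotient.on pi1.

Definition cls (x : K 1%N) : pi1 := \pi_pi1 (x : {classic K 1%N}).
Definition rep (a : pi1) : K 1%N := repr a.

Lemma repK a : cls (rep a) = a. Proof. exact: reprK. Qed.

Lemma clsP x y : cls x = cls y <-> homot x y.
Proof.
split=> [/eqmodP/asboolP //|xy]; apply/eqmodP; exact/asboolP.
Qed.

Definition pi1_one : pi1 := cls const1.
Definition pi1_mul (a b : pi1) : pi1 :=
  cls (projT1 (cid (triangle_fill1 (rep a) (rep b)))).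
Definition pi1_inv (a : pi1) : pi1 :=
  cls (projT1 (cid (triangle_fill0 const1 (rep a)))).

Lemma triangleP a b c : triangle a b c <-> cls b = pi1_mul (cls a) (cls c).
Proof.
rewrite /pi1_mul; case: cid => b' /= t; rewrite clsP.
have ra : homot (rep (cls a)) a by apply/clsP; rewrite repK.
have rc : homot (rep (cls c)) c by apply/clsP; rewrite repK.
have t' : triangle a b' c := triangle_homot ra (homot_refl _) rc t.
split=> [/triangle_uniq|/homot_sym h]; first exact.
exact: triangle_homot (homot_refl _) h (homot_refl _) t'.
Qed.

Fact pi1_mulA : associative pi1_mul.
Proof.
move=> a b c; rewrite -(repK a) -(repK b) -(repK c).
set x := rep a; set y := rep b; set z := rep c.
have [xy t0] := triangle_fill1 x y; have [yz t3] := triangle_fill1 y z.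
have [xyz t2] := triangle_fill1 xy z.
have t1 := tetra1 t0 t2 t3.
move/triangleP: t0 => <-; move/triangleP: t3 => <-.
by move/triangleP: t2 => <-; move/triangleP: t1 => <-.
Qed.

Fact pi1_mul1 : left_id pi1_one pi1_mul.
Proof. by move=> a; rewrite -(repK a); apply/esym/triangleP/triangle_deg1. Qed.

Fact pi1_mulr1 : right_id pi1_one pi1_mul.
Proof. by move=> a; rewrite -(repK a); apply/esym/triangleP/triangle_deg0. Qed.

Fact pi1_mulV : left_inverse pi1_one pi1_inv pi1_mul.
Proof.
move=> a; rewrite /pi1_inv; case: cid => x /= t.
by rewrite -{1}(repK a); apply/esym/triangleP.
Qed.

Fact pi1_mulrV : right_inverse pi1_one pi1_inv pi1_mul.
Proof.
move=> a; rewrite -[LHS]pi1_mul1 -(pi1_mulV (pi1_inv a)) -pi1_mulA.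
by rewrite (pi1_mulA (pi1_inv a)) pi1_mulV pi1_mul1.
Qed.

HB.instance Definition _ := isGroup.Build pi1
  pi1_mulA pi1_mul1 pi1_mulr1 pi1_mulV pi1_mulrV.

Lemma cls_mul (z : K 2) :
  cls (face (inord 1%N) z) = cls (face (inord 0) z) * cls (face (inord 2) z).
Proof. by apply/triangleP; exists z. Qed.

Lemma cls_const1 : cls const1 = 1. Proof. by []. Qed.
End Pi1.
Arguments cls {K}.

Section Pi1Action.
Variables (G : groupType) (K : ovkan) (A : saction G K).

Lemma act_const1 g : A g 1%N (const1 K) = const1 K.
Proof. by rewrite /const1 sfun_degen (vertexP (A g 0 _)). Qed.

Lemma act_triangle g (a b c : K 1%N) :
  triangle a b c -> triangle (A g 1%N a) (A g 1%N b) (A g 1%N c).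
Proof.
by move=> [z [<- <- <-]]; exists (A g 2 z); split; rewrite sfun_face.
Qed.

Definition pi1_act (g : G) (a : pi1 K) : pi1 K := cls (A g 1%N (rep a)).

Lemma pi1_actE g (x : K 1%N) : pi1_act g (cls x) = cls (A g 1%N x).
Proof.
apply/clsP; rewrite /homot -(act_const1 g); apply: act_triangle.
by apply/clsP; rewrite repK.
Qed.

Fact pi1_act_morph g : {morph pi1_act g : a b / a * b}.
Proof.
move=> a b; rewrite -(repK a) -(repK b).
have [c t] := triangle_fill1 (rep a) (rep b).
have -> : cls (rep a) * cls (rep b) = cls c by apply/esym/triangleP.
by rewrite !pi1_actE; apply/triangleP/act_triangle.
Qed.

HB.instance Definition _ g :=
  isMultiplicative.Build (pi1 K) (pi1 K) (pi1_act g) (pi1_act_morph g).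

Lemma pi1_act1 a : pi1_act 1 a = a.
Proof. by rewrite -(repK a) pi1_actE sact1. Qed.

Lemma pi1_actM g h a : pi1_act (g * h) a = pi1_act g (pi1_act h a).
Proof. by rewrite -(repK a) !pi1_actE sactM. Qed.
End Pi1Action.

Definition normalg (P : groupType) (H : {pred P}) : Prop :=
  forall x y, x \in H -> x ^ y \in H.

Section QuotientGroup.
Variables (P : groupType) (H : groupClosed P).

Definition lcoset_rel : rel P := fun x y => x^-1 * y \in H.

Fact lcoset_refl : reflexive lcoset_rel.
Proof. by move=> x; rewrite /lcoset_rel mulVg gpred1. Qed.

Fact lcoset_sym : symmetric lcoset_rel.
Proof. by move=> x y; rewrite /lcoset_rel -gpredV invgM invgK. Qed.

Fact lcoset_trans : transitive lcoset_rel.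
Proof.
move=> y x z xy yz; rewrite /lcoset_rel.
by rewrite -(mulVKg y z) mulgA; apply: gpredM.
Qed.

Canonical lcoset_equiv :=
  EquivRel lcoset_rel lcoset_refl lcoset_sym lcoset_trans.

(* The normality proof is a phantom argument of the type, so that the group
   structure on it can be inferred. *)
Definition quotg (nH : normalg H) : Type := {eq_quot lcoset_equiv}.

Variable nH : normalg H.
HB.instance Definition _ := Choice.on (quotg nH).
HB.instance Definition _ := EqQuotient.on (quotg nH).

Definition coset (x : P) : quotg nH := \pi_(quotg nH) x.

Lemma cosetP x y : coset x = coset y <-> x^-1 * y \in H.
Proof. by split=> [/eqmodP|xy] //; apply/eqmodP. Qed.

Lemma coset_repr (a : quotg nH) : coset (repr a) = a.
Proof. exact: reprK. Qed.

Definition quotg_mul (a b : quotg nH) : quotg nH := coset (repr a * repr b).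
Definition quotg_inv (a : quotg nH) : quotg nH := coset (repr a)^-1.

Lemma quotg_mulE x y : quotg_mul (coset x) (coset y) = coset (x * y).
Proof.
have /cosetP hx := coset_repr (coset x); have /cosetP hy := coset_repr (coset y).
apply/cosetP; rewrite invgM; move: (repr _) (repr _) hx hy => v u hx hy.
have -> : v^-1 * u^-1 * (x * y) = (v^-1 * y) * ((u^-1 * x) ^ y).
  by rewrite conjgE !mulgA mulgK.
by apply: gpredM => //; apply: nH.
Qed.

Lemma quotg_invE x : quotg_inv (coset x) = coset x^-1.
Proof.
have /cosetP hx := coset_repr (coset x); apply/cosetP; rewrite invgK.
move: (repr _) hx => u /(nH x^-1); rewrite conjgE invgK mulgK => h.
by rewrite -gpredV invgM invgK.
Qed.

Fact quotg_mulA : associative quotg_mul.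
Proof.
move=> a b c; rewrite -(coset_repr a) -(coset_repr b) -(coset_repr c).
by rewrite !quotg_mulE mulgA.
Qed.
Fact quotg_mul1 : left_id (coset 1) quotg_mul.
Proof. by move=> a; rewrite -(coset_repr a) quotg_mulE mul1g. Qed.
Fact quotg_mulr1 : right_id (coset 1) quotg_mul.
Proof. by move=> a; rewrite -(coset_repr a) quotg_mulE mulg1. Qed.
Fact quotg_mulV : left_inverse (coset 1) quotg_inv quotg_mul.
Proof. by move=> a; rewrite -(coset_repr a) quotg_invE quotg_mulE mulVg. Qed.
Fact quotg_mulrV : right_inverse (coset 1) quotg_inv quotg_mul.
Proof. by move=> a; rewrite -(coset_repr a) quotg_invE quotg_mulE mulgV. Qed.

HB.instance Definition _ := isGroup.Build (quotg nH)
  quotg_mulA quotg_mul1 quotg_mulr1 quotg_mulV quotg_mulrV.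

Fact coset_morph : {morph coset : x y / x * y}.
Proof. by move=> x y; rewrite -quotg_mulE. Qed.
HB.instance Definition _ :=
  isMultiplicative.Build P (quotg nH) coset coset_morph.

Lemma coset1 : coset 1 = 1. Proof. by []. Qed.
Lemma cosetV x : coset x^-1 = (coset x)^-1.
Proof. by rewrite -quotg_invE. Qed.
End QuotientGroup.
Arguments coset {P H} nH.

(* A homomorphism from G to Aut(N). *)
Record autact (G N : groupType) := AutAct {
  aact :> G -> N -> N;
  aact_morph : forall g, {morph aact g : a b / a * b};
  aact1 : forall a, aact 1 a = a;
  aactM : forall g h a, aact (g * h) a = aact g (aact h a)
}.

Section InducedAction.
Variables (G : groupType) (K : ovkan) (A : saction G K).
Variables (H : groupClosed (pi1 K)) (nH : normalg H).
Hypothesis AH : forall g, pi1_act A g @` [set` H] = [set` H].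

Definition quotg_act (g : G) (a : quotg nH) : quotg nH :=
  coset nH (pi1_act A g (repr a)).

Lemma quotg_actE g x : quotg_act g (coset nH x) = coset nH (pi1_act A g x).
Proof.
have /cosetP := coset_repr (coset nH x).
rewrite /quotg_act; move: (repr _) => u ux; apply/cosetP.
have V v : (pi1_act A g v)^-1 = pi1_act A g v^-1.
  apply: mulg1_eq; rewrite -gmulfM mulgV.
  by apply: (mulgI (pi1_act A g 1)); rewrite -gmulfM !mulg1.
rewrite V -gmulfM.
suff : [set` H] (pi1_act A g (u^-1 * x)) by [].
by rewrite -(AH g); exists (u^-1 * x).
Qed.

Fact quotg_act_morph g : {morph quotg_act g : a b / a * b}.
Proof.
move=> a b; rewrite -(coset_repr a) -(coset_repr b).
by rewrite -coset_morph !quotg_actE pi1_act_morph coset_morph.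
Qed.

Fact quotg_act1 a : quotg_act 1 a = a.
Proof. by rewrite -(coset_repr a) quotg_actE pi1_act1. Qed.

Fact quotg_actM g h a : quotg_act (g * h) a = quotg_act g (quotg_act h a).
Proof. by rewrite -(coset_repr a) !quotg_actE pi1_actM. Qed.

Definition induced_action : autact G (quotg nH) :=
  AutAct quotg_act_morph quotg_act1 quotg_actM.
End InducedAction.

Section SplitExtension.
Variables G N : groupType.

Definition split_ext of autact G N : Type := (N * G)%type.

Variable phi : autact G N.
HB.instance Definition _ := Choice.on (split_ext phi).

Definition ext_mul (x y : split_ext phi) : split_ext phi :=
  (x.1 * phi x.2 y.1, x.2 * y.2).
Definition ext_one : split_ext phi := (1, 1).
Definition ext_inv (x : split_ext phi) : split_ext phi :=
  (phi x.2^-1 x.1^-1, x.2^-1).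

Fact aact_one g : phi g 1 = 1.
Proof. by apply: (mulgI (phi g 1)); rewrite -aact_morph !mulg1. Qed.

Fact ext_mulA : associative ext_mul.
Proof.
by move=> x y z; congr pair => /=; rewrite ?aact_morph ?aactM !mulgA.
Qed.
Fact ext_mul1 : left_id ext_one ext_mul.
Proof. by case=> a g; congr pair => /=; rewrite ?aact1 mul1g. Qed.
Fact ext_mulr1 : right_id ext_one ext_mul.
Proof. by case=> a g; congr pair => /=; rewrite ?aact_one mulg1. Qed.
Fact ext_mulV : left_inverse ext_one ext_inv ext_mul.
Proof.
by case=> a g; congr pair => /=; rewrite -?aact_morph mulVg ?aact_one.
Qed.
Fact ext_mulrV : right_inverse ext_one ext_inv ext_mul.
Proof.
by case=> a g; congr pair => /=; rewrite -?aactM ?mulgV ?aact1 ?mulgV.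
Qed.

HB.instance Definition _ := isGroup.Build (split_ext phi)
  ext_mulA ext_mul1 ext_mulr1 ext_mulV ext_mulrV.

Definition ext_incl (a : N) : split_ext phi := (a, 1).
Definition ext_proj (x : split_ext phi) : G := x.2.

Fact ext_incl_morph : {morph ext_incl : a b / a * b}.
Proof. by move=> a b; congr pair => /=; rewrite ?aact1 ?mulg1. Qed.
HB.instance Definition _ :=
  isMultiplicative.Build N (split_ext phi) ext_incl ext_incl_morph.

Fact ext_proj_morph : {morph ext_proj : x y / x * y}.
Proof. by []. Qed.
HB.instance Definition _ :=
  isMultiplicative.Build (split_ext phi) G ext_proj ext_proj_morph.

Lemma ext_incl_inj : injective ext_incl. Proof. by move=> a b []. Qed.
Lemma ext_proj_surj g : exists x, ext_proj x = g. Proof. by exists (1, g). Qed.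
Lemma ext_exact x : ext_proj x = 1 <-> exists a, x = ext_incl a.
Proof.
by case: x => a g; split=> [/= ->|[b ->] //]; exists a.
Qed.
End SplitExtension.
Arguments ext_incl {G N} phi.
Arguments ext_proj {G N} phi.

Section Cover.
Variables (K : ovkan) (H : groupClosed (pi1 K)) (nH : normalg H).

(* The iterated face [face ord0 ^ n] of an (n+1)-simplex. *)
Fixpoint last_edge n : K n.+1 -> K 1%N :=
  if n is m.+1 then fun x => last_edge (face ord0 x) else id.

Lemma last_edgeS n (x : K n.+2) : last_edge x = last_edge (face ord0 x).
Proof. by []. Qed.

Definition cover_spx (n : nat) : Type := (K n * quotg nH)%type.

Definition cover_face n (i : 'I_n.+2) (u : cover_spx n.+1) : cover_spx n :=
  (face i u.1,
   if i == ord_max then (coset nH (cls (last_edge u.1)))^-1 * u.2 else u.2).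

Definition cover_degen n (i : 'I_n.+1) (u : cover_spx n) : cover_spx n.+1 :=
  (degen i u.1, u.2).

Lemma last_edge_face n (i : 'I_n.+3) (x : K n.+2) :
  i <= n -> last_edge (face i x) = last_edge (face ord0 x).
Proof.
elim: n i x => [|n IH] i x.
  by case: i => [[|//] p] _; congr (last_edge (face _ x)); apply: val_inj.
case: (unliftP ord0 i) => [j ->|-> //]; rewrite lift0 ltnS => jn /=.
rewrite face_face // IH //; congr (last_edge (face _ (face _ x))).
exact: val_inj.
Qed.

Lemma last_edge_degen n (j : 'I_n.+2) (x : K n.+1) :
  j <= n -> last_edge (degen j x) = last_edge x.
Proof.
elim: n j x => [|n IH] j x.
  move=> j0; rewrite (_ : j = ord0); last first.
    by apply: val_inj; case: j j0 => [[|]].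
  rewrite /= (_ : ord0 = ord_widen ord0 :> 'I_3); last exact: val_inj.
  by rewrite face_degen_id.
case: (unliftP ord0 j) => [i ->|-> _ /=]; last first.
  rewrite (_ : ord0 = ord_widen ord0 :> 'I_n.+4); last exact: val_inj.
  by rewrite face_degen_id.
rewrite lift0 ltnS => jn; rewrite last_edgeS [RHS]last_edgeS.
rewrite (_ : ord0 = ord_widen ord0 :> 'I_n.+4); last exact: val_inj.
by rewrite face_degen_le // IH //; congr (last_edge (face _ x)); exact: val_inj.
Qed.

Lemma last_edge_degen_max n (x : K n) :
  last_edge (degen ord_max x) = const1 K.
Proof.
elim: n x => [|n IH] x.
  by rewrite /const1 (vertexP x) /=; congr degen; exact: val_inj.
rewrite (_ : ord_max = ord_succ ord_max :> 'I_n.+2); last exact: val_inj.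
rewrite last_edgeS (_ : ord0 = ord_widen ord0 :> 'I_n.+3); last exact: val_inj.
by rewrite face_degen_le // IH.
Qed.

Lemma last_edge_mul n (x : K n.+2) :
  cls (last_edge (face (ord_widen ord_max) x)) =
  cls (last_edge (face ord0 x)) * cls (last_edge (face ord_max x)).
Proof.
elim: n x => [|n IH] x.
  have e0 : inord 0 = ord0 :> 'I_3 by apply: val_inj; rewrite /= inordK.
  have e1 : inord 1%N = ord_widen ord_max :> 'I_3.
    by apply: val_inj; rewrite /= inordK.
  have e2 : inord 2 = ord_max :> 'I_3 by apply: val_inj; rewrite /= inordK.
  by have := cls_mul x; rewrite e0 e1 e2.
have fx (j : 'I_n.+3) :
    face ord0 (face (ord_succ j) x) = face j (face ord0 x).
  rewrite face_face //; congr (face _ (face _ x)); exact: val_inj.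
have e1 : ord_widen ord_max = ord_succ (ord_widen ord_max) :> 'I_n.+4.
  exact: val_inj.
have e2 : ord_max = ord_succ ord_max :> 'I_n.+4 by exact: val_inj.
rewrite e1 e2 !(last_edgeS (face _ x)) !fx.
exact: IH.
Qed.

Lemma ord_succ_max n (i : 'I_n.+1) : (ord_succ i == ord_max) = (i == ord_max).
Proof. by rewrite -!val_eqE /= /bump leq0n. Qed.

Lemma ord_widen_max n (i : 'I_n.+1) : (ord_widen i == ord_max) = false.
Proof. by rewrite -val_eqE /= ltn_eqF. Qed.

Fact cover_face_face n (i j : 'I_n.+2) (x : cover_spx n.+2) : i <= j ->
  cover_face i (cover_face (ord_succ j) x) =
  cover_face j (cover_face (ord_widen i) x).
Proof.
case: x => x a ij; rewrite /cover_face /= ord_succ_max ord_widen_max.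
congr pair; first exact: face_face.
case: (eqVneq j ord_max) => [jE|jN]; last first.
  case: eqVneq => // iE; case/eqP: jN; apply/val_inj/eqP.
  by rewrite eqn_leq leq_ord -iE ij.
rewrite {}jE /= in ij *; case: (eqVneq i ord_max) => [->|iN].
  rewrite mulgA -invgM -coset_morph last_edge_mul.
  by rewrite (_ : ord_succ ord_max = ord_max) //; apply: val_inj.
rewrite last_edge_face //; move: iN (ltn_ord i).
by rewrite -val_eqE ltnS leq_eqVlt => /negPf ->.
Qed.

Fact cover_degen_degen n (i j : 'I_n.+1) (x : cover_spx n) : i <= j ->
  cover_degen (ord_succ j) (cover_degen i x) =
  cover_degen (ord_widen i) (cover_degen j x).
Proof. by move=> ij; rewrite /cover_degen /= degen_degen. Qed.

Fact cover_face_degen_le n (i : 'I_n.+2) (j : 'I_n.+1) (x : cover_spx n.+1) :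
  i <= j ->
  cover_face (ord_widen i) (cover_degen (ord_succ j) x) =
  cover_degen j (cover_face i x).
Proof.
move=> ij; rewrite /cover_degen /cover_face /= ord_widen_max face_degen_le //.
by case: eqVneq ij => // ->; rewrite leqNgt ltn_ord.
Qed.

Fact cover_face_degen_id n (j : 'I_n.+1) (x : cover_spx n) :
  cover_face (ord_widen j) (cover_degen j x) = x.
Proof.
by case: x => x a; rewrite /cover_face /= ord_widen_max face_degen_id.
Qed.

Fact cover_face_degen_succ n (j : 'I_n.+1) (x : cover_spx n) :
  cover_face (ord_succ j) (cover_degen j x) = x.
Proof.
case: x => x a; rewrite /cover_face /= ord_succ_max face_degen_succ.
congr pair; case: eqVneq => // ->.
by rewrite last_edge_degen_max cls_const1 coset1 invg1 mul1g.
Qed.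

Fact cover_face_degen_gt n (i : 'I_n.+2) (j : 'I_n.+1) (x : cover_spx n.+1) :
  j < i ->
  cover_face (ord_succ i) (cover_degen (ord_widen j) x) =
  cover_degen j (cover_face i x).
Proof.
move=> ji; rewrite /cover_degen /cover_face /= ord_succ_max face_degen_gt //.
rewrite -last_edgeS last_edge_degen //; exact: (leq_ord j).
Qed.

Definition reg_cover : sset :=
  SSet cover_face_face cover_degen_degen cover_face_degen_le
       cover_face_degen_id cover_face_degen_succ cover_face_degen_gt.

Fact cover_kan : is_kan reg_cover.
Proof.
move=> n k y yE.
have [|x hx] := ov_kan (k := k) (y := fun i => (y i).1).
  by move=> i j ij ik jk; have := congr1 fst (yE i j ij ik jk).
pose c m (z : K m.+1) := coset nH (cls (last_edge z)).
pose b i := if i == ord_max then c _ x * (y i).2 else (y i).2.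
have b_lt (i j : 'I_n.+2) : i <= j -> ord_widen i != k -> ord_succ j != k ->
    b (ord_widen i) = b (ord_succ j).
  move=> ij ik jk; have := congr1 snd (yE i j ij ik jk).
  rewrite /b /= -(hx _ ik) -(hx _ jk) ord_succ_max ord_widen_max.
  case: (eqVneq j ord_max) => [jE|jN]; last first.
    case: eqVneq => // iE; case/eqP: jN; apply/val_inj/eqP.
    by rewrite eqn_leq leq_ord; rewrite iE in ij.
  rewrite {}jE {ij jk}; case: (eqVneq i ord_max) => [->|iN] h.
    apply: (mulgI (coset nH (cls (last_edge (face (ord_widen ord_max) x))))^-1).
    rewrite -h last_edge_mul coset_morph invgM -mulgA mulKg.
    by rewrite (_ : ord_succ ord_max = ord_max) //; apply: val_inj.
  rewrite h last_edge_face; first by rewrite mulVKg.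
  by move: iN (ltn_ord i); rewrite -val_eqE ltnS leq_eqVlt => /negPf ->.
have b_eq i j : i != k -> j != k -> b i = b j.
  wlog ij : i j / i < j.
    move=> W ik jk; case: (ltngtP i j) => ij; [exact: W|exact/esym/W|].
    by congr b; apply: val_inj.
  have i2 : i < n.+2 by rewrite (leq_trans ij) ?leq_ord.
  case: (unliftP ord0 j) ij => [j' ->|-> //]; rewrite lift0 ltnS => ij.
  have -> : i = ord_widen (Ordinal i2) by exact: val_inj.
  exact: b_lt.
pose i0 : 'I_n.+3 := if k == ord0 then ord_max else ord0.
have i0k : i0 != k by rewrite /i0; case: (eqVneq k ord0) => [->|] //; rewrite eq_sym.
exists (x, b i0) => i ik; rewrite (b_eq _ _ i0k ik).
rewrite [y i]surjective_pairing -(hx _ ik); congr pair.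
by rewrite /= /b; case: eqVneq => // _; rewrite mulKg.
Qed.

Definition cover_proj : smap reg_cover K :=
  @SMap reg_cover K (fun _ => fst) (fun _ _ _ => erefl) (fun _ _ _ => erefl).

Definition deck_fun (b : quotg nH) n (x : reg_cover n) : reg_cover n :=
  (x.1, x.2 * b).

Fact deck_face b n (i : 'I_n.+2) (x : reg_cover n.+1) :
  deck_fun b (face i x) = face i (deck_fun b x).
Proof.
by congr pair => /=; case: eqP => // _; rewrite mulgA.
Qed.

Definition deck_map (b : quotg nH) : smap reg_cover reg_cover :=
  @SMap reg_cover reg_cover (@deck_fun b) (@deck_face b) (fun _ _ _ => erefl).

Fact deck1 n (x : reg_cover n) : deck_map 1 n x = x.
Proof. by case: x => x a; congr pair; rewrite /= mulg1. Qed.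

Fact deckM b c n (x : reg_cover n) :
  deck_map (b * c) n x = deck_map c n (deck_map b n x).
Proof. by congr pair; rewrite /= mulgA. Qed.

Definition deck_action : sraction (quotg nH) reg_cover := SRAction deck1 deckM.
End Cover.
Arguments reg_cover {K H} nH.
Arguments cover_proj {K H} nH.
Arguments deck_action {K H} nH.

(* Main.v *)
Require Import Defs.
From HB Require Import structures.
From mathcomp Require Import all_boot boolp classical_sets.

(** The cover looks like a product of [K] with [pi/H], so the candidate for the
    lifted action is the product of the given action with the affine action of
    the split extension on [pi/H]:
      [(b, g) (k, a) = (g k, phi g a * b^-1)].
    The inverse turns right multiplication by [b] into a left action, and the
    law of the semidirect product is what makes this formula an action.  The
    cover is however a twisted product: its last face operator multiplies the
    second factor on the left by the inverse of the class of an edge of [k].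
    Left multiplication commutes with [b^-1] acting on the right, and [phi g]
    carries the class of the edge of [k] to the class of the corresponding edge
    of [g k], because [phi g] is by definition induced by [[x] |-> [g x]]; so
    the action is simplicial (lemma [lift_face]).

    Both the extension property and equivariance are read off from the formula.
    For the isotropy groups, [(b, g)] fixes [(k, a)] if and only if [g] fixes
    [k] and [phi g a * b^-1 = a], and the latter has exactly one solution
    [b = a^-1 * phi g a].  This reflects the fact that [pi/H] permutes each fibre
    simply transitively, and it means that [eta] restricts to an isomorphism
    from the isotropy group of [(k, a)] to that of [k]. *)

Set Implicit Arguments.
Unset Strict Implicit.
Unset Printing Implicit Defensive.

Local Open Scope classical_set_scope.
Local Open Scope group_scope.

Section AffineAction.
Variables (G N : groupType) (phi : autact G N).

(** The left action of the split extension on [N] whose restriction to [N] is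
    the one associated with right multiplication. *)
Definition affine (l : split_ext phi) (a : N) : N := phi l.2 a * l.1^-1.

Lemma aactV g a : phi g a^-1 = (phi g a)^-1.
Proof. by apply/esym/mulg1_eq; rewrite -aact_morph mulgV aact_one. Qed.

Lemma affine1 a : affine 1 a = a.
Proof. by rewrite /affine aact1 invg1 mulg1. Qed.

Lemma affineM l m a : affine (l * m) a = affine l (affine m a).
Proof. by rewrite /affine aactM invgM !aact_morph aactV mulgA. Qed.

Lemma affine_mulVl l c a : affine l (c^-1 * a) = (phi l.2 c)^-1 * affine l a.
Proof. by rewrite /affine aact_morph aactV mulgA. Qed.

Lemma affine_fix l a : affine l a = a <-> l.1 = a^-1 * phi l.2 a.
Proof.
rewrite /affine; split=> [{1}<-|->]; first by rewrite invgM invgK mulgVK.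
by rewrite invgM invgK mulVKg.
Qed.
End AffineAction.

Section LiftedAction.
Variables (K : ovkan) (G : groupType) (A : saction G K).
Variables (H : groupClosed (pi1 K)) (nH : normalg H).
Hypothesis AH : forall g : G, pi1_act A g @` [set` H] = [set` H].

Local Notation phi := (induced_action nH AH).
Local Notation L := (split_ext phi).

Lemma last_edge_act g n (x : K n.+1) :
  last_edge (A g n.+1 x) = A g 1%N (last_edge x).
Proof. by elim: n x => [//|n IH] x; rewrite !last_edgeS -sfun_face IH. Qed.

Lemma induced_action_cls g (x : K 1%N) :
  phi g (coset nH (cls x)) = coset nH (cls (A g 1%N x)).
Proof. by rewrite -pi1_actE; exact: quotg_actE. Qed.

Definition lift_fun (l : L) n (x : reg_cover nH n) : reg_cover nH n :=
  (A l.2 n x.1, affine l x.2).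

(** Only the last face is at stake, where [phi] must carry the twisting of the
    cover at [k] to its twisting at [g k]. *)
Lemma lift_face (l : L) n (i : 'I_n.+2) (x : reg_cover nH n.+1) :
  lift_fun l (face i x) = face i (lift_fun l x).
Proof.
case: x => k a; congr pair => /=; first exact: sfun_face.
case: eqP => // _.
by rewrite affine_mulVl induced_action_cls last_edge_act.
Qed.

Lemma lift_degen (l : L) n (i : 'I_n.+1) (x : reg_cover nH n) :
  lift_fun l (degen i x) = degen i (lift_fun l x).
Proof. by congr pair; exact: sfun_degen. Qed.

Definition lift_map (l : L) : smap (reg_cover nH) (reg_cover nH) :=
  SMap (lift_face l) (lift_degen l).

Lemma lift1 n (x : reg_cover nH n) : lift_map 1 n x = x.
Proof. by case: x => k a; congr pair; [exact: sact1 | exact: affine1]. Qed.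

Lemma liftM (l m : L) n (x : reg_cover nH n) :
  lift_map (l * m) n x = lift_map l n (lift_map m n x).
Proof. by congr pair; [exact: sactM | exact: affineM]. Qed.

Definition lifted_action : saction L (reg_cover nH) := SAction lift1 liftM.

Section Isotropy.
Variables (n : nat) (x : reg_cover nH n).

Local Notation Lx := (isotropy lifted_action x).
Local Notation Gx := (isotropy A (cover_proj nH n x)).

Lemma isotropy_proj (l : Lx) : isotropy_pred A (cover_proj nH n x) (val l).2.
Proof. by apply/asboolP; have /asboolP/(congr1 fst) := valP l. Qed.

Definition isotropy_map (l : Lx) : Gx := exist _ (val l).2 (isotropy_proj l).

Fact isotropy_map_morph : {morph isotropy_map : l m / l * m}.
Proof. by move=> l m; exact: val_inj. Qed.

HB.instance Definition _ :=
  isMultiplicative.Build Lx Gx isotropy_map isotropy_map_morph.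

(** The only element of the extension above [g] that fixes [x], when [g] fixes
    the projection of [x]. *)
Definition isotropy_section (g : G) : L := (x.2^-1 * phi g x.2, g).

Lemma isotropy_sectionP (g : Gx) :
  isotropy_pred lifted_action x (isotropy_section (val g)).
Proof.
have /asboolP gx := valP g; apply/asboolP.
by rewrite [RHS]surjective_pairing; congr pair => //; apply/affine_fix.
Qed.

Lemma isotropy_map_bij : bijective isotropy_map.
Proof.
exists (fun g => exist _ (isotropy_section (val g)) (isotropy_sectionP g))
  => [l|g]; apply: val_inj => //.
have /asboolP/(congr1 snd)/affine_fix lx := valP l.
by rewrite [RHS]surjective_pairing lx.
Qed.
End Isotropy.
End LiftedAction.

Theorem theorem5p2 (K : ovkan) (G : groupType) (A : saction G K)
    (H : groupClosed (pi1 K)) (nH : normalg H)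
    (AH : forall g : G, pi1_act A g @` [set` H] = [set` H]) :
  let phi : autact G (quotg nH) := induced_action nH AH in
  let L : groupType := split_ext phi in
  let eta : {multiplicative L -> G} := ext_proj phi in
  let psi : sraction (quotg nH) (reg_cover nH) := deck_action nH in
  let p : smap (reg_cover nH) K := cover_proj nH in
  exists B : saction L (reg_cover nH),
    [/\ forall (b : quotg nH) n (x : reg_cover nH n),
          B (ext_incl phi b) n x = left_of_right psi b n x,
        forall (l : L) n (x : reg_cover nH n), p n (B l n x) = A (eta l) n (p n x)
      & forall n (x : reg_cover nH n),
          exists theta : {multiplicative isotropy B x -> isotropy A (p n x)},
            bijective theta /\
            forall l : isotropy B x, val (theta l) = eta (val l)].
Proof.
move=> phi L eta psi p; exists (lifted_action nH AH); split=> [b n x|//|n x].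
  congr pair; first exact: sact1.
  by congr (_ * _); exact: (aact1 phi).
by exists (@isotropy_map K G A H nH AH n x); split=> //; exact: isotropy_map_bij.
Qed.
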